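(* For every $n \geq 3$, the linearization map $\Phi\colon \mathfrak{A}_n \rightarrow \mathfrak{sl}_n(\mathbb{Q})$, defined on generators by $\Phi([f,v]_0) = f \otimes v$, is an isomorphism of $\mathbb{Q}$-vector spaces.
   Context: $\mathfrak{sl}_n(\mathbb{Q})$ denotes the kernel of the trace map $\operatorname{tr}\colon (\mathbb{Q}^n)^{\ast} \otimes \mathbb{Q}^n \to \mathbb{Q}$, $f \otimes v \mapsto f(v)$. Here $(\mathbb{Q}^n)^{\ast} = \operatorname{Hom}(\mathbb{Q}^n,\mathbb{Q})$, which contains the lattice $(\mathbb{Z}^n)^{\ast} = \operatorname{Hom}(\mathbb{Z}^n,\mathbb{Z})$. A set of vectors in a finitely generated free abelian group is a partial basis if it can be extended to a basis; a vector $v$ is primitive if $\{v\}$ is a partial basis. For $f \in (\mathbb{Z}^n)^{\ast}$, $\ker(f) \subset \mathbb{Z}^n$ is its kernel; for $v \in \mathbb{Z}^n$, $\ker(v) = \{f \in (\mathbb{Z}^n)^{\ast} : f(v)=0\}$. $\mathfrak{A}_n$ is the $\mathbb{Q}$-vector space with the following presentation. Generators: a formal symbol $[f,v]_0$ for all primitive vectors $f \in (\mathbb{Z}^n)^{\ast}$ and $v \in \mathbb{Z}^n$ such that $f(v)=0$. Relations: (1) for all primitive $f \in (\mathbb{Z}^n)^{\ast}$ and all partial bases $\{v_1,v_2\}$ of $\ker(f)$, the relation $[f,v_1+v_2]_0 = [f,v_1]_0+[f,v_2]_0$; (2) for all primitive $v \in \mathbb{Z}^n$ and all partial bases $\{f_1,f_2\}$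 of $\ker(v)$, the relation $[f_1+f_2,v]_0 = [f_1,v]_0+[f_2,v]_0$. The formula $\Phi([f,v]_0) = f \otimes v$ takes relations to relations, so it gives a well-defined linear map $\mathfrak{A}_n \to (\mathbb{Q}^n)^{\ast}\otimes \mathbb{Q}^n$ whose image lies in $\mathfrak{sl}_n(\mathbb{Q})$. *)

(* Defs.v *)
From HB Require Import structures.
From mathcomp Require Import all_boot all_order all_algebra generic_quotient.
From mathcomp Require Import boolp.
From mathcomp Require Import freeg.

Set Implicit Arguments.
Unset Strict Implicit.
Unset Printing Implicit Defensive.
Set Warnings "-redundant-canonical-projection".

Import GRing.Theory.
Local Open Scope ring_scope.
Local Open Scope quotient_scope.

Section Presentation.
Variables (F : fieldType) (G : choiceType).

Definition rel_span (rel : {freeg G / F} -> Prop) : {pred {freeg G / F}} :=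
  [pred x | `[< exists s : seq (F * {freeg G / F}),
     (forall r, r \in s -> rel r.2) /\ x = \sum_(r <- s) r.1 *: r.2 >]].

Variable rel : {freeg G / F} -> Prop.

Lemma rel_span_lin a x y :
  x \in rel_span rel -> y \in rel_span rel -> a *: x + y \in rel_span rel.
Proof.
move=> /asboolP[s [hs ->]] /asboolP[t [ht ->]]; apply/asboolP.
exists ([seq (a * r.1, r.2) | r <- s] ++ t); split=> [r|].
  by rewrite mem_cat => /orP[/mapP[r' /hs ? ->]|/ht].
rewrite big_cat big_map scaler_sumr; congr (_ + _).
by apply: eq_bigr => r _; rewrite scalerA.
Qed.

Lemma rel_span0 : 0 \in rel_span rel.
Proof. by apply/asboolP; exists [::]; split=> //; rewrite big_nil. Qed.

Lemma mem_rel_span r : rel r -> r \in rel_span rel.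
Proof.
move=> hr; apply/asboolP; exists [:: (1, r)]; split=> [x|].
  by rewrite inE => /eqP->.
by rewrite big_seq1 scale1r.
Qed.

Lemma rel_span_zmod_closed : zmod_closed (rel_span rel).
Proof.
split=> [|x y hx hy]; first exact: rel_span0.
by rewrite addrC -scaleN1r; apply: rel_span_lin.
Qed.

HB.instance Definition _ :=
  GRing.isZmodClosed.Build {freeg G / F} (rel_span rel) rel_span_zmod_closed.

Definition presented := Quotient.quot (rel_span rel).

HB.instance Definition _ := Choice.on presented.
HB.instance Definition _ := GRing.Zmodule.on presented.

Definition pres_pi (x : {freeg G / F}) : presented := \pi_presented x.

Lemma pres_pi_eq x y : (pres_pi x = pres_pi y) <-> (x - y \in rel_span rel).
Proof.
rewrite /pres_pi -[X in _ <-> is_true X]/(Quotient.equiv (rel_span rel) x y).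
by split=> [/eqP|h]; last apply/eqP; rewrite -Quotient.idealrBE.
Qed.

Lemma pres_piK x : pres_pi (repr x) = x. Proof. exact: reprK. Qed.

Lemma pres_piD : {morph pres_pi : x y / x + y}.
Proof. by move=> x y; rewrite /pres_pi !piE. Qed.

Definition pres_scale (a : F) (x : presented) : presented :=
  pres_pi (a *: repr x).

Lemma pres_pi_scale a x : pres_scale a (pres_pi x) = pres_pi (a *: x).
Proof.
apply/pres_pi_eq; rewrite -scalerBr -[X in X \in _]addr0.
by apply: rel_span_lin (rel_span0); apply/pres_pi_eq; rewrite pres_piK.
Qed.

Fact pres_scalerA a b x : pres_scale a (pres_scale b x) = pres_scale (a * b) x.
Proof. by rewrite -[x]pres_piK !pres_pi_scale scalerA. Qed.

Fact pres_scale1r : left_id 1 pres_scale.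
Proof. by move=> x; rewrite -[x]pres_piK !pres_pi_scale scale1r. Qed.

Fact pres_scalerDr : right_distributive pres_scale +%R.
Proof.
move=> a x y; rewrite -[x]pres_piK -[y]pres_piK.
by rewrite -pres_piD !pres_pi_scale scalerDr pres_piD.
Qed.

Fact pres_scalerDl x : {morph pres_scale^~ x : a b / a + b}.
Proof.
move=> a b; rewrite -[x]pres_piK.
by rewrite !pres_pi_scale scalerDl pres_piD.
Qed.

HB.instance Definition _ := GRing.Zmodule_isLmodule.Build F presented
  pres_scalerA pres_scale1r pres_scalerDr pres_scalerDl.

Definition pres_gen (g : G) : presented := pres_pi << g >>.

Section Lift.
Variables (M : lmodType F) (h : G -> M).

Fact fglift_linear : linear (fglift h).
Proof.
have hD : {morph fglift h : x y / x + y}.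
  have hB := lift_is_additive h.
  have h0 : fglift h 0 = 0 by have := hB 0 0; rewrite !subrr.
  move=> x y; rewrite -[y in LHS]opprK hB.
  by rewrite -[- y]sub0r hB h0 sub0r opprK.
have h0 : fglift h 0 = 0.
  by apply: (addrI (fglift h 0)); rewrite -hD !addr0.
have hZ a c z : a *: << c *g z >> = << a * c *g z >> :> {freeg G / F}.
  by apply/eqP/freeg_eqP => t; rewrite coeffZ !coeffU mulrA.
move=> a x y; rewrite hD; congr (_ + _).
rewrite -{1}[x]freeg_sumE -{3}[x]freeg_sumE !scaler_sumr !(big_morph _ hD h0).
by rewrite scaler_sumr; apply: eq_bigr => z _; rewrite hZ !liftU scalerA.
Qed.

(* Linear only when [h] kills the relations; see [pres_lift]. *)
Definition pres_lift_fun (x : presented) : M := fglift h (repr x).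

Hypothesis hrel : forall r, rel r -> fglift h r = 0.

Lemma fglift_rel_span x : x \in rel_span rel -> fglift h x = 0.
Proof.
pose H : {linear {freeg G / F} -> M} :=
  HB.pack (fglift h) (GRing.isLinear.Build _ _ _ _ _ fglift_linear).
move=> /asboolP[s [hs ->]]; rewrite -[fglift h]/(H : _ -> _) raddf_sum big_seq.
rewrite big1 // => r /hs/hrel r0; have := linearZ_LR H r.1 r.2 => /= ->.
by rewrite r0 scaler0.
Qed.

Lemma pres_lift_pi x : pres_lift_fun (pres_pi x) = fglift h x.
Proof.
pose H : {linear {freeg G / F} -> M} :=
  HB.pack (fglift h) (GRing.isLinear.Build _ _ _ _ _ fglift_linear).
apply/eqP; rewrite -subr_eq0 /pres_lift_fun; have /= <- := raddfB H.
apply/eqP; apply: fglift_rel_span.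
by apply/pres_pi_eq; rewrite pres_piK.
Qed.

Fact pres_lift_linear : linear pres_lift_fun.
Proof.
move=> a x y; rewrite -[x]pres_piK -[y]pres_piK.
rewrite -[a *: _]/(pres_scale _ _) pres_pi_scale -pres_piD !pres_lift_pi.
exact: fglift_linear.
Qed.

Definition pres_lift : {linear presented -> M} :=
  HB.pack pres_lift_fun (GRing.isLinear.Build _ _ _ _ _ pres_lift_linear).

Lemma pres_lift_gen g : pres_lift (pres_gen g) = h g.
Proof. by rewrite /= pres_lift_pi liftU scale1r. Qed.

End Lift.

End Presentation.

Section Tensor.
Variables (F : fieldType) (U V : lmodType F).

Variant tensor_rel : {freeg (U * V)%type / F} -> Prop :=
| TensorDl u1 u2 v :
    tensor_rel (<< (u1 + u2, v) >> - << (u1, v) >> - << (u2, v) >>)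
| TensorDr u v1 v2 :
    tensor_rel (<< (u, v1 + v2) >> - << (u, v1) >> - << (u, v2) >>)
| TensorZl a u v : tensor_rel (<< (a *: u, v) >> - a *: << (u, v) >>)
| TensorZr a u v : tensor_rel (<< (u, a *: v) >> - a *: << (u, v) >>).

Definition tensor : lmodType F := presented tensor_rel.

Definition tens (u : U) (v : V) : tensor := pres_gen tensor_rel (u, v).

End Tensor.

Section IntegralBases.
Variable L : zmodType.
Implicit Types (K : {pred L}) (b s t : seq L) (c : nat -> int) (v w x y : L).

Definition int_comb b c : L := \sum_(i < size b) b`_i *~ c i.

Definition is_basis K b : Prop :=
  [/\ {subset b <= K},
      forall c, int_comb b c = 0 -> forall i, (i < size b)%N -> c i = 0
    & forall x, x \in K -> exists c, x = int_comb b c].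

(* A list enumerates a set without repetition: independence of [s ++ t] makes *)
(* the entries of a partial basis pairwise distinct.                          *)
Definition partial_basis K s : Prop := exists t, is_basis K (s ++ t).

Definition primitive v : Prop := partial_basis predT [:: v].

Lemma int_comb_cons v b c :
  int_comb (v :: b) c = v *~ c 0%N + int_comb b (fun i => c i.+1).
Proof. by rewrite /int_comb /= big_ord_recl. Qed.

Lemma is_basis_swap K x y t :
  is_basis K [:: x, y & t] -> is_basis K [:: y, x & t].
Proof.
pose sw c i := if i is j.+2 then c i else c (1 - i)%N.
have swE x' y' c : int_comb [:: x', y' & t] c = int_comb [:: y', x' & t] (sw c).
  by rewrite !int_comb_cons /= addrCA.
case=> sub ind span; split=> [z hz|c|z /span[c ->]]; last 1 first.
- by exists (sw c); rewrite swE.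
- by apply: sub; move: hz; rewrite !inE orbCA.
- rewrite swE => /ind h0 i hi.
  case: i hi => [|[|i]] hi; [exact: (h0 1%N) | exact: (h0 0%N) |].
  exact: (h0 i.+2).
Qed.

Lemma is_basis_add K x y t :
  x + y \in K -> is_basis K [:: x, y & t] -> is_basis K [:: x + y, y & t].
Proof.
move=> hxy; pose sh (e : int) c i : int := if i is 1%N then c 1%N + e * c 0%N else c i.
have shE c : int_comb [:: x + y, y & t] c = int_comb [:: x, y & t] (sh 1 c).
  rewrite !int_comb_cons /= mul1r mulrzDl mulrzDr -!addrA; congr (_ + _).
  by rewrite addrCA.
case=> sub ind span; split=> [z|c|z /span[c ->]]; last 1 first.
- exists (sh (-1) c); rewrite shE !int_comb_cons /=.
  by rewrite mul1r mulN1r addrNK.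
- rewrite inE => /predU1P[->|hz] //; apply: sub.
  by rewrite inE hz orbT.
- rewrite shE => /ind h0 i hi.
  have c0 : c 0%N = 0 by exact: (h0 0%N).
  case: i hi => [|[|i]] hi //; last exact: (h0 i.+2).
  by have := h0 1%N isT; rewrite /= c0 mulr0 addr0.
Qed.

Lemma is_basis_ker (phi : {additive L -> int}) w b : phi w = 1 ->
  is_basis [pred x | phi x == 0] b -> is_basis predT (w :: b).
Proof.
move=> pw [sub ind span].
have phiz x (m : int) : phi (x *~ m) = phi x * m.
  by rewrite raddfMz -mulrzr intz.
have pb c : phi (int_comb b c) = 0.
  rewrite raddf_sum big1 // => i _; rewrite phiz.
  have /sub : b`_i \in b by rewrite mem_nth.
  by rewrite inE => /eqP->; rewrite mul0r.
split=> // [c|x _]; rewrite ?int_comb_cons.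
- move=> e0; have /eqP := congr1 phi e0.
  rewrite raddfD /= phiz pb pw raddf0 mul1r addr0 => /eqP c0.
  move: e0; rewrite c0 mulr0z add0r => /ind h0 [|i] //; exact: h0.
- have /span[c hc] : x - w *~ phi x \in [pred x | phi x == 0].
    by rewrite inE raddfB /= phiz pw mul1r subrr.
  exists (fun i => if i is j.+1 then c j else phi x).
  by rewrite int_comb_cons /= -hc addrC subrK.
Qed.

Lemma partial_basis_ker_primitive (phi : {additive L -> int}) w v1 v2 :
    phi w = 1 -> partial_basis [pred x | phi x == 0] [:: v1; v2] ->
  [/\ primitive v1, primitive v2 & primitive (v1 + v2)].
Proof.
move=> pw [t ht].
have prim x u : is_basis [pred x | phi x == 0] (x :: u) -> primitive x.
  by move=> /(is_basis_ker pw)/is_basis_swap ?; exists (w :: u).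
split; [exact: prim ht | exact: prim (is_basis_swap ht) |].
apply: prim (is_basis_add _ ht); have [sub _ _] := ht.
have := sub v1; have := sub v2; rewrite !inE !eqxx orbT => /(_ isT)/eqP h2.
by move=> /(_ isT)/eqP h1; rewrite raddfD /= h1 h2.
Qed.

Lemma primitive_functional v :
  primitive v -> exists phi : {additive L -> int}, phi v = 1.
Proof.
case=> t [_ ind span].
have sp x : exists c, x = int_comb (v :: t) c by exact: span.
pose co x := projT1 (cid (sp x)).
have coE x : x = int_comb (v :: t) (co x) by rewrite /co; case: cid.
pose phi x := co x 0%N.
have phi_uniq x c : x = int_comb (v :: t) c -> phi x = c 0%N.
  move=> xE; apply/eqP; rewrite -subr_eq0; apply/eqP.
  apply: (ind (fun i => co x i - c i) _ 0%N) => //.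
  rewrite /int_comb (eq_bigr (fun i : 'I__ =>
    (v :: t)`_i *~ co x i - (v :: t)`_i *~ c i)).
    by rewrite sumrB -[X in X - _]/(int_comb _ _) -coE [x in x - _]xE subrr.
  by move=> i _; rewrite mulrzBr.
have phiB : zmod_morphism phi.
  move=> x y; rewrite (phi_uniq _ (fun i => co x i - co y i)) //.
  rewrite {1}[x]coE {1}[y]coE /int_comb -sumrB.
  by apply: eq_bigr => i _; rewrite mulrzBr.
pose P : {additive L -> int} :=
  HB.pack phi (GRing.isZmodMorphism.Build _ _ phi phiB).
exists P; rewrite /= (phi_uniq _ (fun i => (i == 0%N)%:Z)) //.
by rewrite int_comb_cons mulr1z /int_comb big1 ?addr0.
Qed.

End IntegralBases.

Notation lattice n := 'cV[int]_n.
Notation dual_lattice n := 'Hom('cV[int]_n, int^o).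
Notation vecQ n := 'cV[rat]_n.
Notation dualQ n := 'Hom('cV[rat]_n, rat^o).

Section LatticePairing.
Variable n : nat.
Implicit Types (f : dual_lattice n) (v : lattice n).

Definition ker_form f : {pred lattice n} := [pred v | f v == 0].
Definition ker_vec v : {pred dual_lattice n} := [pred f : dual_lattice n | f v == 0].

Definition is_generator f v : Prop := [/\ primitive f, primitive v & f v = 0].

Fact ev_is_additive v : zmod_morphism (fun f : dual_lattice n => (f v : int)).
Proof. by move=> f g; rewrite add_lfunE opp_lfunE. Qed.
Definition ev v : {additive dual_lattice n -> int} :=
  HB.pack (fun f : dual_lattice n => (f v : int))
    (GRing.isZmodMorphism.Build _ _ _ (ev_is_additive v)).

Lemma primitive_vec_dual v : primitive v -> exists f, f v = 1.
Proof.
case/primitive_functional => phi pv.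
have lin : linear (phi : lattice n -> int^o).
  move=> a x y; rewrite raddfD /=; congr (_ + _).
  by rewrite -[a]intz scaler_int raddfMz -mulrzl intz.
pose H : {linear lattice n -> int^o} :=
  HB.pack (phi : lattice n -> int^o) (GRing.isLinear.Build _ _ _ _ _ lin).
by exists (linfun H); rewrite lfunE.
Qed.

Fact coord_is_linear (j : 'I_n) :
  linear (fun v : lattice n => v j 0 : int^o).
Proof. by move=> a x y; rewrite !mxE. Qed.
Definition coord_linear (j : 'I_n) : {linear lattice n -> int^o} :=
  HB.pack (fun v : lattice n => v j 0 : int^o)
    (GRing.isLinear.Build _ _ _ _ _ (coord_is_linear j)).
Definition coord (j : 'I_n) : dual_lattice n := linfun (coord_linear j).

Lemma primitive_form_dual f : primitive f -> exists v, f v = 1.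
Proof.
case/primitive_functional => phi pf.
exists (\col_j phi (coord j)); rewrite -[RHS]pf.
have -> : f = \sum_j coord j *~ f (delta_mx j 0).
  apply/lfunP => v; rewrite sum_lfunE.
  rewrite {1}[v]matrix_sum_delta linear_sum; apply: eq_bigr => j _.
  rewrite big_ord1 linearZ -scaler_int scale_lfunE lfunE /= intz.
  exact: (mulrC (v j 0)).
rewrite sum_lfunE raddf_sum; apply: eq_bigr => j _.
by rewrite raddfMz -scaler_int scale_lfunE lfunE /= mxE intz -mulrzr intz mulrC.
Qed.

Lemma ker_form_generators f v1 v2 :
    primitive f -> partial_basis (ker_form f) [:: v1; v2] ->
  [/\ is_generator f v1, is_generator f v2 & is_generator f (v1 + v2)].
Proof.
move=> pf hb; have [w fw] := primitive_form_dual pf.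
have [p1 p2 p12] :=
  partial_basis_ker_primitive (phi := f : {linear lattice n -> int^o}) fw hb.
have [t [sub _ _]] := hb.
have h1 : f v1 = 0 by apply/eqP/sub; rewrite inE eqxx.
have h2 : f v2 = 0 by apply/eqP/sub; rewrite !inE eqxx orbT.
by split; split=> //; rewrite linearD /= h1 h2.
Qed.

Lemma ker_vec_generators v f1 f2 :
    primitive v -> partial_basis (ker_vec v) [:: f1; f2] ->
  [/\ is_generator f1 v, is_generator f2 v & is_generator (f1 + f2) v].
Proof.
move=> pv hb; have [w vw] := primitive_vec_dual pv.
have [p1 p2 p12] := partial_basis_ker_primitive (phi := ev v) vw hb.
have [t [sub _ _]] := hb.
have h1 : f1 v = 0 by apply/eqP/sub; rewrite inE eqxx.
have h2 : f2 v = 0 by apply/eqP/sub; rewrite !inE eqxx orbT.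
by split; split=> //; rewrite add_lfunE h1 h2.
Qed.

End LatticePairing.

Section TensorTheory.
Variables (F : fieldType) (U V : lmodType F).

Lemma tensDl (u1 u2 : U) (v : V) : tens (u1 + u2) v = tens u1 v + tens u2 v.
Proof.
rewrite /tens /pres_gen -pres_piD; apply/pres_pi_eq/mem_rel_span.
by rewrite opprD addrA; exact: TensorDl.
Qed.

Lemma tensDr (u : U) (v1 v2 : V) : tens u (v1 + v2) = tens u v1 + tens u v2.
Proof.
rewrite /tens /pres_gen -pres_piD; apply/pres_pi_eq/mem_rel_span.
by rewrite opprD addrA; exact: TensorDr.
Qed.

Lemma tensZl a (u : U) (v : V) : tens (a *: u) v = a *: tens u v.
Proof.
rewrite /tens /pres_gen -[RHS]/(pres_scale _ _) pres_pi_scale.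
by apply/pres_pi_eq/mem_rel_span; exact: TensorZl.
Qed.

Lemma tensZr a (u : U) (v : V) : tens u (a *: v) = a *: tens u v.
Proof.
rewrite /tens /pres_gen -[RHS]/(pres_scale _ _) pres_pi_scale.
by apply/pres_pi_eq/mem_rel_span; exact: TensorZr.
Qed.

End TensorTheory.

Section TraceMap.
Variable n : nat.

Definition pairing (p : dualQ n * vecQ n) : rat^o := p.1 p.2.

Fact pairing_tensor_rel r : tensor_rel r -> fglift pairing r = 0.
Proof.
have lin := fglift_linear pairing.
pose H : {linear {freeg (dualQ n * vecQ n)%type / rat} -> rat^o} :=
  HB.pack (fglift pairing) (GRing.isLinear.Build _ _ _ _ _ lin).
have HU p : H << p >> = pairing p by rewrite /= liftU scale1r.
rewrite -[fglift pairing]/(H : _ -> _).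
case=> [f1 f2 v|f v1 v2|a f v|a f v]; rewrite !linearB ?linearZ !HU /pairing /=.
- by rewrite add_lfunE addrAC addrK subrr.
- by rewrite linearD /= addrAC addrK subrr.
- by rewrite scale_lfunE -scalerDr subrr scaler0.
- by rewrite linearZ -scalerDr subrr scaler0.
Qed.

Definition trace_map : {linear tensor (dualQ n) (vecQ n) -> rat^o} :=
  pres_lift pairing_tensor_rel.

Lemma trace_map_tens f v : trace_map (tens f v) = f v.
Proof. exact: pres_lift_gen. Qed.

Definition ker_trace : {pred tensor (dualQ n) (vecQ n)} :=
  [pred x | trace_map x == 0].

Fact ker_trace_submod_closed : submod_closed ker_trace.
Proof.
split=> [|a x y /eqP hx /eqP hy]; apply/eqP; first exact: raddf0.
by rewrite linearP hx hy scaler0 addr0.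
Qed.

HB.instance Definition _ :=
  GRing.isSubmodClosed.Build rat (tensor (dualQ n) (vecQ n)) ker_trace
    ker_trace_submod_closed.

Record sl : Type := Sl { sl_val; _ : sl_val \in ker_trace }.

HB.instance Definition _ := [isSub for sl_val].
HB.instance Definition _ := [Choice of sl by <:].
HB.instance Definition _ := [SubChoice_isSubLmodule of sl by <:].

End TraceMap.

Arguments ker_trace n : clear implicits.
Arguments trace_map n : clear implicits.

Section Linearization.
Variable n : nat.
Implicit Types (f : dual_lattice n) (v : lattice n).

(* [asbool] only serves to make the index type a [choiceType]. *)
Definition generator :=
  {p : dual_lattice n * lattice n | `[< is_generator p.1 p.2 >]}.

Definition generator_of f v (h : is_generator f v) : generator :=
  exist _ (f, v) (asboolT h).

Definition fsymb f v (h : is_generator f v) : {freeg generator / rat} :=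
  << generator_of h >>.

(* [ker_form_generators] and [ker_vec_generators] show that [h1], [h2] and     *)
(* [h12] follow from the other hypotheses, so no relation is lost.            *)
Variant frakA_rel : {freeg generator / rat} -> Prop :=
| RelVec f v1 v2 (h1 : is_generator f v1) (h2 : is_generator f v2)
    (h12 : is_generator f (v1 + v2)) of
    primitive f & partial_basis (ker_form f) [:: v1; v2] :
    frakA_rel (fsymb h12 - (fsymb h1 + fsymb h2))
| RelForm v f1 f2 (h1 : is_generator f1 v) (h2 : is_generator f2 v)
    (h12 : is_generator (f1 + f2) v) of
    primitive v & partial_basis (ker_vec v) [:: f1; f2] :
    frakA_rel (fsymb h12 - (fsymb h1 + fsymb h2)).

Definition frakA : lmodType rat := presented frakA_rel.

Definition symb f v (h : is_generator f v) : frakA :=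
  pres_gen frakA_rel (generator_of h).

Definition vec_incl v : vecQ n := map_mx intr v.

Fact form_incl_is_linear f :
  linear (fun x : vecQ n =>
    \sum_(j < n) x j 0 * (f (delta_mx j 0))%:~R : rat^o).
Proof.
move=> a x y; rewrite scaler_sumr -big_split; apply: eq_bigr => j _ /=.
by rewrite !mxE mulrDl -mulrA.
Qed.

Definition form_incl_linear f : {linear vecQ n -> rat^o} :=
  HB.pack (fun x : vecQ n =>
    \sum_(j < n) x j 0 * (f (delta_mx j 0))%:~R : rat^o)
    (GRing.isLinear.Build _ _ _ _ _ (form_incl_is_linear f)).

(* The rational extension of [f], see [form_inclE]. *)
Definition form_incl f : dualQ n := linfun (form_incl_linear f).

Lemma form_inclE f v : form_incl f (vec_incl v) = (f v)%:~R.
Proof.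
rewrite lfunE /= {2}[v]matrix_sum_delta linear_sum rmorph_sum.
apply: eq_bigr => j _; rewrite big_ord1 linearZ /= mxE.
by rewrite -[RHS]/((v j ord0 * f (delta_mx j ord0))%:~R) intrM.
Qed.

Lemma form_inclD f1 f2 : form_incl (f1 + f2) = form_incl f1 + form_incl f2.
Proof.
apply/lfunP => x; rewrite add_lfunE !lfunE /= -big_split.
by apply: eq_bigr => j _; rewrite add_lfunE /= rmorphD mulrDr.
Qed.

Lemma vec_inclD v1 v2 : vec_incl (v1 + v2) = vec_incl v1 + vec_incl v2.
Proof. exact: map_mxD. Qed.

Definition simple_tensor (g : generator) : tensor (dualQ n) (vecQ n) :=
  tens (form_incl (val g).1) (vec_incl (val g).2).

Fact simple_tensor_trace g : simple_tensor g \in ker_trace n.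
Proof.
apply/eqP; rewrite trace_map_tens form_inclE.
by have /asboolP[_ _ ->] := valP g.
Qed.

Definition Phi_gen (g : generator) : sl n := Sl (simple_tensor_trace g).

Fact Phi_gen_rel r : frakA_rel r -> fglift Phi_gen r = 0.
Proof.
have lin := fglift_linear Phi_gen.
pose H : {linear {freeg generator / rat} -> sl n} :=
  HB.pack (fglift Phi_gen) (GRing.isLinear.Build _ _ _ _ _ lin).
have HU g : H << g >> = Phi_gen g by rewrite /= liftU scale1r.
rewrite -[fglift _]/(H : _ -> _).
case=> [f v1 v2 h1 h2 h12 _ _|v f1 f2 h1 h2 h12 _ _];
  rewrite linearB linearD !HU; apply/eqP; rewrite subr_eq0; apply/eqP/val_inj.
- by rewrite raddfD /= /simple_tensor /= vec_inclD tensDr.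
- by rewrite raddfD /= /simple_tensor /= form_inclD tensDl.
Qed.

Definition Phi : {linear frakA -> sl n} := pres_lift Phi_gen_rel.

Lemma Phi_symb f v (h : is_generator f v) :
  val (Phi (symb h)) = tens (form_incl f) (vec_incl v).
Proof. by rewrite pres_lift_gen. Qed.

End Linearization.

Arguments Phi n : clear implicits.

(* Main.v *)
Require Import Defs.
From HB Require Import structures.
From mathcomp Require Import freeg.
From mathcomp Require Import all_boot all_order all_algebra.
From mathcomp Require Import boolp.

Set Implicit Arguments.
Unset Strict Implicit.
Unset Printing Implicit Defensive.

Import Order.TTheory GRing.Theory Num.Theory.
Local Open Scope ring_scope.

(** Let [e_j] be the standard basis vectors and [E_i] the dual forms. The plan is
    to build a linear map [Psi] from tensors to [frakA n] that is inverse to [Phi]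
    on traceless tensors. Its values on [E_i (x) e_j] for distinct [i], [j] and on
    [E_i (x) e_i - E_0 (x) e_0] are forced, and [Phi \o Psi] is then the identity
    on traceless tensors. The content of the theorem is that [Psi] recovers every
    symbol: [[f, v] = Psi (f (x) v)].

    Making symbols additive. For a fixed form [f], symbols are additive in [v] only
    along partial bases of [ker f]. They extend homogeneously to all integral pairs
    with [f v = 0] by [S (a f, b v) = a b [f, v]] ([extended_symbol]). This is
    consistent because [[f, - v] = - [f, v]], which follows from the relations as
    soon as [ker f] has rank at least [2], that is, [n >= 3]. Any two vectors of
    [ker f] lie in the span of one partial basis [{r, s}] by the Smith normal form
    ([adapted_pair]), and the Euclidean algorithm on coefficients, with
    [{r, s}] replaced by [{r, r + s}], gives [S (f, a r + b s) = a S (f, r) +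
    b S (f, s)] ([partial_basis_additive]). Hence [S] is additive in each variable
    as long as the pairing vanishes ([extended_symbol_addv],
    [extended_symbol_addf]).

    Rigidity. The difference [D (f, v) = S (f, v) - Psi (f (x) v)] is additive in
    the same partial sense, and vanishes at [(E_i, e_j)] for distinct [i], [j] and
    at [(E_i + E_0, e_i - e_0)]. These properties force [D = 0]
    ([partially_biadditive_eq0]). Everything reduces to the values
    [P_ij (a, b) = D (a E_i + b E_j, b e_i - a e_j)]. A linear relation between
    three such vectors in the kernel of a form with three nonzero coordinates gives
    the cocycle identity [c P_ij (a, b) + a P_jk (b, c) = b P_ik (a, c)]
    ([plane_cocycle]); with a third index at hand it reduces everything to the
    functions [P_ij (1, t)], and shows that these are odd in [t]. Over a general
    field what remains could be a nonzero derivation of the field in the variable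
    [t]. Decomposing [E_i + E_j + E_k] inside the kernel of a vector, instead of a
    vector inside the kernel of a form, supplies additivity in the form
    [P_ij (1, t) = P_ij (1, t - 1)], and so [P_ij] vanishes on integers
    ([plane1]). *)

(** * Bases of lattices under unimodular changes *)

Section Frames.
Variable L : zmodType.
Implicit Types (K : {pred L}) (r s x y : L).

(** Listing a basis as a function on ['I_m] lets unimodular matrices act on it
    ([frame_mul]) and puts coordinate vectors in ['rV_m]. *)
Definition frame m (B : 'I_m -> L) : seq L := [seq B i | i <- enum 'I_m].

Lemma int_comb_frame m (B : 'I_m -> L) c :
  int_comb (frame B) c = \sum_(i < m) B i *~ c i.
Proof.
rewrite /int_comb -(big_mkord xpredT (fun i => (frame B)`_i *~ c i)).
rewrite size_map size_enum_ord big_mkord; apply: eq_bigr => i _.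
by rewrite (nth_map i) ?size_enum_ord ?nth_ord_enum.
Qed.

Lemma is_basis_frameP K m (B : 'I_m -> L) :
  is_basis K (frame B) <->
  [/\ forall i, B i \in K,
      forall c : 'rV[int]_m, \sum_i B i *~ c 0 i = 0 -> c = 0
    & forall x, x \in K -> exists c : 'rV[int]_m, x = \sum_i B i *~ c 0 i].
Proof.
split=> -[sub ind span]; split.
- by move=> i; apply: sub; rewrite map_f ?mem_enum.
- move=> c c0; apply/rowP => i; rewrite mxE.
  pose c' k := if insub k is Some j then c 0 j else 0.
  have <- : c' i = c 0 i by rewrite /c' valK.
  apply: (ind c'); last by rewrite size_map size_enum_ord.
  by rewrite int_comb_frame -[RHS]c0; apply: eq_bigr => j _; rewrite /c' valK.
- move=> x /span[c ->]; exists (\row_i c i); rewrite int_comb_frame.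
  by apply: eq_bigr => i _; rewrite mxE.
- by move=> _ /mapP[i _ ->].
- move=> c; rewrite int_comb_frame => c0 i; rewrite size_map size_enum_ord => im.
  have /rowP/(_ (Ordinal im)) : (\row_j c j : 'rV_m) = 0.
    by apply: ind; rewrite -[RHS]c0; apply: eq_bigr => j _; rewrite mxE.
  by rewrite !mxE.
- move=> x /span[c ->]; pose c' k := if insub k is Some j then c 0 j else 0.
  exists c'; rewrite int_comb_frame; apply: eq_bigr => i _.
  by rewrite /c' valK.
Qed.

Definition frame_mul m (R : 'M[int]_m) (B : 'I_m -> L) i : L :=
  \sum_j B j *~ R i j.

(** The coordinates of a vector change by right multiplication by [R]; this is
    why an invertible [R] turns bases into bases. *)
Lemma frame_mul_comb m (R : 'M[int]_m) (B : 'I_m -> L) (c : 'rV_m) :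
  \sum_i frame_mul R B i *~ c 0 i = \sum_j B j *~ (c *m R) 0 j.
Proof.
rewrite (eq_bigr _ (fun i _ => mulrz_suml _ _ _ _)) exchange_big; apply: eq_bigr => j _.
rewrite mxE mulrz_sumr; apply: eq_bigr => i _.
by rewrite -mulrzA mulrC.
Qed.

Lemma is_basis_frame_mul K m (R : 'M[int]_m) (B : 'I_m -> L) :
    zmod_closed K -> R \in unitmx ->
  is_basis K (frame B) -> is_basis K (frame (frame_mul R B)).
Proof.
move=> cK uR /is_basis_frameP[sub ind span]; apply/is_basis_frameP.
pose S : zmodClosed L := HB.pack K (GRing.isZmodClosed.Build L K cK).
split=> [i|c|x /span[c ->]].
- by rewrite -[K]/(S : {pred L}) rpred_sum // => j _; rewrite rpredMz //; apply: sub.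
- rewrite frame_mul_comb => /ind cR0.
  by rewrite -[c](mulmxK uR) cR0 mul0mx.
- by exists (c *m invmx R); rewrite frame_mul_comb mulmxKV.
Qed.

Lemma frame_cons m (B : 'I_m.+1 -> L) :
  frame B = B ord0 :: frame (fun i => B (lift ord0 i)).
Proof. by rewrite /frame enum_ordSl /= -map_comp. Qed.

(** Smith normal form with the left factor absorbed: [p] integral vectors
    involve only [p] vectors of a suitable basis, because a diagonal matrix
    with [p] rows vanishes beyond its first [p] columns. *)
Lemma int_mx_row_reduction p m (X : 'M[int]_(p, m)) :
  exists D R, [/\ R \in unitmx, X = D *m R
                & forall i (j : 'I_m), (p <= j)%N -> D i j = 0].
Proof.
have [P _ [R uR [d _ ->]]] := int_Smith_normal_form X.
set E := \matrix_(i, j) _; exists (P *m E), R; split=> // i j pj.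
rewrite mxE big1 // => k _; rewrite mxE.
by rewrite ltn_eqF ?mulr0 //; apply: leq_trans pj.
Qed.

Lemma adapted_frame K p m (B : 'I_m -> L) (x : 'I_p -> L) :
    zmod_closed K -> is_basis K (frame B) -> (forall i, x i \in K) ->
  exists B' (D : 'M[int]_(p, m)), [/\ is_basis K (frame B'),
    forall i, x i = \sum_j B' j *~ D i j
  & forall i (j : 'I_m), (p <= j)%N -> D i j = 0].
Proof.
move=> cK hB xK; have /is_basis_frameP[_ _ span] := hB.
have /fin_all_exists[c cE] i := span _ (xK i).
have [D [R [uR XE D0]]] := int_mx_row_reduction (\matrix_i c i).
exists (frame_mul R B), D; split=> // [|i]; first exact: is_basis_frame_mul.
rewrite (eq_bigr (fun j => frame_mul R B j *~ (row i D) 0 j)); last first.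
  by move=> j _; rewrite mxE.
by rewrite frame_mul_comb -row_mul -XE rowK.
Qed.

Lemma adapted_frame1 K m (B : 'I_m.+1 -> L) x :
    zmod_closed K -> is_basis K (frame B) -> x \in K ->
  exists2 B' : 'I_m.+1 -> L, is_basis K (frame B') & exists k, x = B' 0 *~ k.
Proof.
move=> cK hB xK.
have [//|B' [D [hB' xE D0]]] := adapted_frame (x := fun _ : 'I_1 => x) cK hB.
exists B' => //; exists (D 0 0); rewrite (xE 0) big_ord_recl big1 ?addr0 // => i _.
by rewrite D0 ?mulr0z.
Qed.

(** This reduces additivity on a lattice of any rank to additivity on the rank
    two sublattices spanned by partial bases. *)
Lemma adapted_pair K m (B : 'I_m.+2 -> L) x y :
    zmod_closed K -> is_basis K (frame B) -> x \in K -> y \in K ->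
  exists r s, partial_basis K [:: r; s] /\
    exists a b c d, x = r *~ a + s *~ b /\ y = r *~ c + s *~ d.
Proof.
move=> cK hB xK yK.
have [i|B' [D [hB' xE D0]]] :=
    adapted_frame (x := fun i : 'I_2 => if i == 0 then x else y) cK hB.
  by case: ifP.
exists (B' 0), (B' (lift ord0 0)); split.
  by rewrite 2!frame_cons in hB'; eexists; exact: hB'.
have span2 i : \sum_j B' j *~ D i j = B' 0 *~ D i 0 + B' (lift ord0 0) *~ D i (lift ord0 0).
  rewrite 2!big_ord_recl big1 ?addr0 // => j _.
  by rewrite D0 ?mulr0z.
exists (D 0 0), (D 0 (lift ord0 0)), (D 1 0), (D 1 (lift ord0 0)).
by split; rewrite -span2 -xE.
Qed.

Lemma is_basis_opp K x t :
  zmod_closed K -> is_basis K (x :: t) -> is_basis K (- x :: t).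
Proof.
move=> cK [sub ind span].
pose ng (c : nat -> int) i := if i is 0%N then - c 0%N else c i.
have ngE c : int_comb (- x :: t) c = int_comb (x :: t) (ng c).
  by rewrite !int_comb_cons mulNrz mulrNz.
split=> [z|c|z /span[c ->]].
- rewrite inE => /predU1P[->|zt]; last by apply: sub; rewrite inE zt orbT.
  by apply: (GRing.zmod_closedN cK); apply: sub; rewrite mem_head.
- rewrite ngE => /ind h0 [|i] /h0 //= /eqP.
  by rewrite oppr_eq0 => /eqP.
- exists (ng c); rewrite ngE !int_comb_cons /=; congr (_ *~ _ + _).
  by rewrite opprK.
Qed.
End Frames.

(** * From additivity on partial bases to additivity *)

Section KernelAdditivity.
Variables (L M : zmodType) (K : {pred L}) (cK : zmod_closed K) (G : L -> M).
Hypothesis G_pb :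
  forall r s, partial_basis K [:: r; s] -> G (r + s) = G r + G s.
Let S : zmodClosed L := HB.pack K (GRing.isZmodClosed.Build L K cK).

Lemma pb_mem r s : partial_basis K [:: r; s] -> r \in S /\ s \in S.
Proof. by case=> t [sub _ _]; split; apply: sub; rewrite !inE eqxx ?orbT. Qed.

Lemma pb_swap r s : partial_basis K [:: r; s] -> partial_basis K [:: s; r].
Proof. by case=> t /is_basis_swap; exists t. Qed.

Lemma pb_opp r s : partial_basis K [:: r; s] -> partial_basis K [:: - r; s].
Proof. by case=> t /(is_basis_opp cK); exists t. Qed.

Lemma pb_add r s : partial_basis K [:: r; s] -> partial_basis K [:: r + s; s].
Proof.
move=> h; have [rK sK] := pb_mem h; case: h => t h; exists t.
by apply: is_basis_add h; rewrite -[K]/(S : {pred L}) rpredD.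
Qed.

(** [{r + s, - r}] is again a partial basis, with sum [s]; comparing
    [G s = G (r + s) + G (- r)] with [G (r + s) = G r + G s] gives the sign.
    The second vector [s] is indispensable. *)
Lemma partial_basis_additiveN r s :
  partial_basis K [:: r; s] -> G (- r) = - G r.
Proof.
move=> h; have h' := pb_opp (pb_swap (pb_add (pb_swap h))).
have := G_pb h'; rewrite addrC addrK (addrC s) (G_pb h) addrA -[LHS]add0r.
by move=> /addIr/esym/eqP; rewrite addr_eq0 => /eqP.
Qed.

Hypothesis GMz : {in K, forall x a, G (x *~ a) = G x *~ a}.

(** Subtractive Euclidean algorithm on the coefficients: for [b <= a],
    [a r + b s = (a - b) r + b (r + s)], and [{r, r + s}] is a partial basis, so
    induction on [a + b] applies. *)
Lemma partial_basis_additive_nat r s (a b : nat) :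
  partial_basis K [:: r; s] -> G (r *+ a + s *+ b) = G r *+ a + G s *+ b.
Proof.
have GMn x k : x \in K -> G (x *+ k) = G x *+ k by move=> /GMz/(_ k%:Z).
have [k] := ubnP (a + b); elim: k => // k IH in a b r s *.
wlog le_ba : a b r s / (b <= a)%N.
  move=> W abk h; case: (leqP b a) => [/W|/ltnW/W W']; first exact.
  rewrite addrC [RHS]addrC; apply: W'; [by rewrite addnC | exact: pb_swap].
case: b le_ba => [|b] le_ba abk h; have [rK sK] := pb_mem h.
  by rewrite !mulr0n !addr0 GMn.
have -> : r *+ a + s *+ b.+1 = (r + s) *+ b.+1 + r *+ (a - b.+1).
  by rewrite mulrnDl addrAC -mulrnDr subnKC.
rewrite addrC IH; last by apply: pb_swap; rewrite (addrC r); apply/pb_add/pb_swap.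
  by rewrite (G_pb h) mulrnDl addrA -mulrnDr subnK.
by rewrite subnK // -ltnS; apply: leq_trans abk; rewrite addnS !ltnS leq_addr.
Qed.

(** Signs of the coefficients are moved onto the basis vectors. *)
Lemma partial_basis_additive_int r s a b :
  partial_basis K [:: r; s] -> G (r *~ a + s *~ b) = G r *~ a + G s *~ b.
Proof.
(* x' carries the sign of c, and n is its absolute value *)
have abs x y c : partial_basis K [:: x; y] -> exists x' n,
    [/\ partial_basis K [:: x'; y], x *~ c = x' *+ n & G x *~ c = G x' *+ n].
  move=> h; have [xK _] := pb_mem h; case: c => n; first by exists x, n.
  exists (- x), n.+1; split; first exact: pb_opp.
    by rewrite NegzE mulrNz mulNrn.
  by rewrite -[- x]/(x *~ -1) GMz // NegzE mulrNz mulNrn.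
move=> /(abs _ _ a)[r' [m [/pb_swap h -> ->]]].
have [s' [n [/pb_swap h' -> ->]]] := abs _ _ b h.
exact: partial_basis_additive_nat.
Qed.

Lemma partial_basis_additive m (B : 'I_m.+2 -> L) :
  is_basis K (frame B) -> {in K &, {morph G : x y / x + y}}.
Proof.
move=> hB x y xK yK.
have [r [s [h [a [b [c [d [-> ->]]]]]]]] := adapted_pair cK hB xK yK.
by rewrite addrACA -!mulrzDr !partial_basis_additive_int // !mulrzDr addrACA.
Qed.
End KernelAdditivity.

Lemma int_raddfMz (L : zmodType) (phi : {additive L -> int}) x a :
  phi (x *~ a) = phi x * a.
Proof. by rewrite raddfMz -mulrzr intz. Qed.

Section Kernel.
Variables (L : zmodType) (phi : {additive L -> int}).

Lemma ker_zmod_closed : zmod_closed [pred x | phi x == 0].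
Proof.
split=> [|x y]; rewrite !inE ?raddf0 // raddfB.
by move=> /eqP-> /eqP->.
Qed.

(** Row reduction of the column of values of [phi] on a basis produces a basis
    on which [phi] vanishes except at the first vector; the others then form a
    basis of the kernel. *)
Lemma ker_frame m (B : 'I_m.+1 -> L) w :
  phi w != 0 -> is_basis predT (frame B) ->
  exists B' : 'I_m -> L, is_basis [pred x | phi x == 0] (frame B').
Proof.
move=> pw hB.
have [P uP [R _ [d _ ME]]] := int_Smith_normal_form (\col_i phi (B i)).
set E := \matrix_(i, j) (_ *+ _) in ME.
have E0 (i : 'I_m) : (E *m R) (lift ord0 i) 0 = 0.
  by rewrite mxE big_ord1 !mxE mulr0n mul0r.
have uP' : invmx P \in unitmx by rewrite unitmx_inv.
have hB' := is_basis_frame_mul (conj isT (fun _ _ _ _ => isT)) uP' hB.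
set B' := frame_mul _ _ in hB'.
have pB' i : phi (B' i) = (E *m R) i 0.
  rewrite -[E *m R](mulKmx uP) (mulmxA P) -ME mxE raddf_sum.
  by apply: eq_bigr => j _; rewrite int_raddfMz mxE mulrC.
exists (fun i => B' (lift ord0 i)); apply/is_basis_frameP.
have /is_basis_frameP[_ ind span] := hB'.
have p0 : phi (B' ord0) != 0.
  apply: contra_neq pw => p0; have [//|c ->] := span w.
  rewrite raddf_sum big1 // => i _; rewrite int_raddfMz.
  by case: (unliftP ord0 i) => [j|] ->; rewrite ?p0 ?pB' ?E0 mul0r.
split=> [i|c c0|x /eqP px].
- by rewrite inE pB' E0.
- pose c' : 'rV_m.+1 := \row_i oapp (c 0) 0 (unlift ord0 i).
  have /ind/rowP c'0 : \sum_i B' i *~ c' 0 i = 0.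
    rewrite big_ord_recl mxE unlift_none mulr0z add0r -[RHS]c0.
    by apply: eq_bigr => i _; rewrite mxE liftK.
  by apply/rowP => i; have := c'0 (lift ord0 i); rewrite !mxE liftK.
- have [//|c cE] := span x; exists (\row_i c 0 (lift ord0 i)).
  rewrite cE big_ord_recl; move: px; rewrite cE raddf_sum big_ord_recl big1.
    rewrite addr0 /= int_raddfMz => /eqP; rewrite mulf_eq0 (negPf p0) => /eqP ->.
    by rewrite add0r; apply: eq_bigr => i _; rewrite mxE.
  by move=> i _; rewrite /= int_raddfMz pB' E0 mul0r.
Qed.
End Kernel.

(** * Primitive vectors *)

Lemma primitiveN (L : zmodType) (r : L) : primitive r -> primitive (- r).
Proof. by case=> t ht; exists t; apply: is_basis_opp ht. Qed.

Section Primitive.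
Variables (L : zmodType) (m : nat) (B : 'I_m.+1 -> L).
Hypothesis hB : is_basis predT (frame B).

Lemma frame_torsion_free (x : L) a : x *~ a = 0 -> a = 0 \/ x = 0.
Proof.
have /is_basis_frameP[_ ind span] := hB.
have [//|c ->] := span x; rewrite mulrz_suml => xa0.
have [->|a0] := eqVneq a 0; [by left | right].
have /rowP ca0 : a *: c = 0.
  by apply: ind; rewrite -[RHS]xa0; apply: eq_bigr => i _; rewrite mxE -mulrzA mulrC.
rewrite big1 // => i _; have /eqP := ca0 i.
by rewrite !mxE mulf_eq0 (negPf a0) => /eqP->.
Qed.

Lemma primitive_part (x : L) : exists r a, primitive r /\ x = r *~ a.
Proof.
have [|//|B' hB' [k ->]] := adapted_frame1 (x := x) _ hB; first by split.
by exists (B' 0), k; split=> //; rewrite frame_cons in hB'; eexists; exact: hB'.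
Qed.

(** Uniqueness of the primitive part up to sign. Functionals equal to [1] on [r]
    and on [s] show that [a] and [b] divide each other. *)
Lemma primitive_mulrz_inj (r s : L) a b :
    primitive r -> primitive s -> r *~ a != 0 -> r *~ a = s *~ b ->
  r = s /\ a = b \/ r = - s /\ a = - b.
Proof.
move=> /primitive_functional[phi pr] /primitive_functional[psi ps] ra0 E.
have phiE := congr1 phi E; have psiE := congr1 psi E.
rewrite !int_raddfMz pr ps !mul1r in phiE psiE.
have a0 : a != 0 by apply: contra_neq ra0 => ->.
have /intUnitRing.unitzPl : phi s * psi r = 1.
  by apply: (mulIf a0); rewrite mul1r -mulrA psiE -phiE.
have rs u : b = a * u -> r = s *~ u.
  move=> bE; have /frame_torsion_free[/eqP|/eqP] : (r - s *~ u) *~ a = 0.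
  - by rewrite mulrzBl E bE -mulrzA (mulrC u) subrr.
  - by rewrite (negPf a0).
  - by rewrite subr_eq0 => /eqP.
case/orP=> /eqP pr1; rewrite pr1 in psiE; [left | right].
  by rewrite (rs 1) -?psiE ?mulr1 ?mul1r.
by rewrite (rs (- 1)) -?psiE ?mulrN1 ?mulN1r ?opprK ?mulrNz.
Qed.
End Primitive.

(** A vector that is primitive in [L] is, up to sign, the first vector of a basis
    of [K], so that [partial_basis_additiveN] applies to it. *)
Lemma primitive_additiveN (L M : zmodType) (K : {pred L}) (G : L -> M) m
    (B : 'I_m.+2 -> L) (v : L) :
    zmod_closed K -> is_basis K (frame B) ->
    (forall r s, partial_basis K [:: r; s] -> G (r + s) = G r + G s) ->
  primitive v -> v \in K -> G (- v) = - G v.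
Proof.
move=> cK hB G_pb /primitive_functional[phi pv] vK.
have [B' hB' [k vE]] := adapted_frame1 cK hB vK.
have pb : partial_basis K [:: B' 0; B' (lift ord0 0)].
  by rewrite 2!frame_cons in hB'; eexists; exact: hB'.
have GN := partial_basis_additiveN cK G_pb pb.
have : phi (B' 0) * k = 1 by rewrite -int_raddfMz -vE.
by case/intUnitRing.unitzPl/orP => /eqP kE; rewrite vE kE ?mulrNz mulr1z ?opprK ?GN ?opprK.
Qed.

(** * The standard lattice and its dual *)

(** The name [coord] alone denotes coordinates in a vector space. *)
Local Notation dcoord := (@Defs.coord _).

Section IntegralLattices.
Variable n : nat.
Implicit Types (f : dual_lattice n) (v : lattice n).

Local Notation e j := (delta_mx j 0 : lattice n).

Lemma lattice_frame : is_basis predT (frame (fun j => e j)).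
Proof.
have comb (c : 'rV[int]_n) i : (\sum_j e j *~ c 0 j) i 0 = c 0 i.
  rewrite summxE (bigD1 i) //= big1 ?addr0 => [|j ji].
    by rewrite -scaler_int !mxE !eqxx mulr1 intz.
  by rewrite -scaler_int !mxE eq_sym (negPf ji) mulr0.
apply/is_basis_frameP; split=> // [c c0|x _].
  by apply/rowP => i; rewrite -comb c0 !mxE.
by exists x^T; apply/colP => i; rewrite comb mxE.
Qed.

Lemma dcoordE j v : dcoord j v = v j 0. Proof. by rewrite lfunE. Qed.

Lemma dcoord_delta i j : dcoord i (e j) = (i == j)%:R.
Proof. by rewrite dcoordE mxE eqxx andbT. Qed.

Lemma mulz_lfunE f a v : (f *~ a) v = f v * a.
Proof. by rewrite -scaler_int scale_lfunE intz; exact: (mulrC a). Qed.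

Lemma form_coord f : f = \sum_j dcoord j *~ f (e j).
Proof.
apply/lfunP => v; rewrite sum_lfunE.
rewrite {1}[v]matrix_sum_delta linear_sum; apply: eq_bigr => j _.
by rewrite big_ord1 linearZ mulz_lfunE dcoordE.
Qed.

Lemma vec_coord v : v = \sum_j e j *~ v j 0.
Proof.
rewrite {1}[v]matrix_sum_delta; apply: eq_bigr => j _.
by rewrite big_ord1 -scaler_int intz.
Qed.

Lemma dual_lattice_frame : is_basis predT (frame (@Defs.coord n)).
Proof.
apply/is_basis_frameP; split=> // [c c0|f _]; last first.
  exists (\row_j f (e j)); rewrite {1}(form_coord f).
  by apply: eq_bigr => j _; rewrite mxE.
apply/rowP => i; rewrite mxE.
have := congr1 (fun f => f (e i)) c0; rewrite sum_lfunE (bigD1 i) //= big1.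
  by rewrite addr0 mulz_lfunE dcoord_delta eqxx mul1r zero_lfunE.
by move=> j ji; rewrite mulz_lfunE dcoord_delta (negPf ji) mul0r.
Qed.

Lemma form_incl_mulz f a : form_incl (f *~ a) = a%:~R *: form_incl f.
Proof.
apply/lfunP => x; rewrite scale_lfunE !lfunE /= scaler_sumr.
by apply: eq_bigr => j _; rewrite mulz_lfunE intrM mulrA mulrC.
Qed.

Lemma vec_incl_mulz v a : vec_incl (v *~ a) = a%:~R *: vec_incl v.
Proof.
by apply/matrixP => i j; rewrite !mxE -scaler_int mxE intz intrM.
Qed.
End IntegralLattices.

(** * Symbols of arbitrary integral pairs *)

Section ExtendedSymbol.
Variable m : nat.
Local Notation n := m.+3.
Implicit Types (f : dual_lattice n) (v : lattice n).

(** Symbols carry a proof that they are generators; the total version makes them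
    functions of the pair alone. *)
Definition symb_or0 f v : frakA n :=
  if pselect (is_generator f v) is left h then symb h else 0.

Lemma symb_or0E f v (h : is_generator f v) : symb_or0 f v = symb h.
Proof.
rewrite /symb_or0; case: pselect => [h'|//].
by congr (pres_gen _ _); apply: val_inj.
Qed.

Lemma frakA_relE (x y z : {freeg (generator n) / rat}) :
  frakA_rel (x - (y + z)) ->
  pres_pi (@frakA_rel n) x = pres_pi (@frakA_rel n) y + pres_pi (@frakA_rel n) z.
Proof. by move=> h; rewrite -pres_piD; apply/pres_pi_eq/mem_rel_span. Qed.

Lemma symb_or0_addv f : primitive f -> forall v1 v2,
  partial_basis (ker_form f) [:: v1; v2] ->
  symb_or0 f (v1 + v2) = symb_or0 f v1 + symb_or0 f v2.
Proof.
move=> pf v1 v2 pb; have [h1 h2 h12] := ker_form_generators pf pb.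
by rewrite !symb_or0E; apply: frakA_relE; apply: RelVec.
Qed.

Lemma symb_or0_addf v : primitive v -> forall f1 f2,
  partial_basis (ker_vec v) [:: f1; f2] ->
  symb_or0 (f1 + f2) v = symb_or0 f1 v + symb_or0 f2 v.
Proof.
move=> pv f1 f2 pb; have [h1 h2 h12] := ker_vec_generators pv pb.
by rewrite !symb_or0E; apply: frakA_relE; apply: RelForm.
Qed.

Lemma ker_form_frame f : primitive f ->
  exists B : 'I_m.+2 -> lattice n, is_basis (ker_form f) (frame B).
Proof.
case/primitive_form_dual => w fw.
apply: (ker_frame (phi := f : {linear lattice n -> int^o}) (w := w)).
  by rewrite /= fw.
exact: lattice_frame.
Qed.

Lemma ker_vec_frame v : primitive v ->
  exists B : 'I_m.+2 -> dual_lattice n, is_basis (ker_vec v) (frame B).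
Proof.
case/primitive_vec_dual => w vw.
apply: (ker_frame (phi := ev v) (w := w)); first by rewrite /= vw.
exact: dual_lattice_frame.
Qed.

Lemma ker_form_closed f : zmod_closed (ker_form f).
Proof. exact: (ker_zmod_closed (f : {linear lattice n -> int^o})). Qed.

Lemma ker_vec_closed v : zmod_closed (ker_vec v).
Proof. exact: (ker_zmod_closed (ev v)). Qed.

Lemma symb_or0Nv f v :
  is_generator f v -> symb_or0 f (- v) = - symb_or0 f v.
Proof.
move=> [pf pv fv0]; have [B hB] := ker_form_frame pf.
apply: (primitive_additiveN (ker_form_closed f) hB (symb_or0_addv pf) pv).
by rewrite inE fv0.
Qed.

Lemma symb_or0Nf f v :
  is_generator f v -> symb_or0 (- f) v = - symb_or0 f v.
Proof.
move=> [pf pv fv0]; have [B hB] := ker_vec_frame pv.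
apply: (primitive_additiveN (ker_vec_closed v) hB (symb_or0_addf pv) pf).
by rewrite inE fv0.
Qed.

Lemma primitive_vec_part v : exists v' b, primitive v' /\ v = v' *~ b.
Proof. exact: primitive_part (lattice_frame n) v. Qed.

Lemma primitive_form_part f : exists f' a, primitive f' /\ f = f' *~ a.
Proof. exact: primitive_part (dual_lattice_frame n) f. Qed.

Lemma lfun_mulz f v a : f (v *~ a) = f v * a.
Proof. exact: (int_raddfMz (f : {linear lattice n -> int^o})). Qed.

(** The homogeneous extension [S (a f, b v) = a b [f, v]]. The primitive parts
    of a pair of nonzero vectors are unique up to sign, and the sign rules for
    symbols show that the value does not depend on the choice. *)
Lemma extended_symbol : exists S : dual_lattice n -> lattice n -> frakA n,
  [/\ forall v, S 0 v = 0, forall f, S f 0 = 0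
    & forall f v a b, is_generator f v ->
        S (f *~ a) (v *~ b) = symb_or0 f v *~ (a * b)].
Proof.
(* Prescribing the value at pairs with a zero entry avoids exhibiting a
   generator of which such a pair is a multiple. *)
pose P f v s := [/\ f = 0 -> s = 0, v = 0 -> s = 0 &
  forall f' v' a b, is_generator f' v' -> f = f' *~ a -> v = v' *~ b ->
    s = symb_or0 f' v' *~ (a * b)].
have prim0 (L : zmodType) (x : L) a : primitive x -> x *~ a = 0 -> a = 0.
  move=> /primitive_functional[phi px] xa0; have := congr1 phi xa0.
  by rewrite int_raddfMz px mul1r raddf0.
have exP f v : exists s, P f v s.
  (* a pair that is not a multiple of a generator gets the value 0 *)
  case: (pselect (exists g : (dual_lattice n * int) * (lattice n * int),
    [/\ is_generator g.1.1 g.2.1, f = g.1.1 *~ g.1.2 & v = g.2.1 *~ g.2.2])); last first.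
    move=> no; exists 0; split=> // f' v' a b g fE vE; case: no.
    by exists ((f', a), (v', b)).
  case=> -[[f1 a1] [v1 b1]] /= [g1 fE1 vE1].
  have [pf1 pv1 _] := g1.
  exists (symb_or0 f1 v1 *~ (a1 * b1)); split.
  - by rewrite fE1 => /(prim0 _ _ _ pf1) ->; rewrite mul0r.
  - by rewrite vE1 => /(prim0 _ _ _ pv1) ->; rewrite mulr0.
  move=> f2 v2 a2 b2 g2 fE2 vE2; have [pf2 pv2 _] := g2.
  have [f0|f0] := eqVneq f 0.
    rewrite (prim0 _ _ _ pf1 (etrans (esym fE1) f0)).
    by rewrite (prim0 _ _ _ pf2 (etrans (esym fE2) f0)) !mul0r.
  have [v0|v0] := eqVneq v 0.
    rewrite (prim0 _ _ _ pv1 (etrans (esym vE1) v0)).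
    by rewrite (prim0 _ _ _ pv2 (etrans (esym vE2) v0)) !mulr0.
  rewrite fE1 in f0 fE2; rewrite vE1 in v0 vE2.
  have := primitive_mulrz_inj (dual_lattice_frame n) pf1 pf2 f0 fE2.
  have := primitive_mulrz_inj (lattice_frame n) pv1 pv2 v0 vE2.
  have neg (x : frakA n) k : (- x) *~ - k = x *~ k.
    by rewrite mulNrz mulrNz opprK.
  have g2' : is_generator f2 (- v2).
    split=> //; first exact: primitiveN.
    by rewrite linearN /=; have [_ _ ->] := g2; rewrite oppr0.
  case=> -[vv ->] [] [ff ->]; rewrite vv ff //.
  - by rewrite symb_or0Nf // mulNr neg.
  - by rewrite symb_or0Nv // mulrN neg.
  - by rewrite symb_or0Nf // symb_or0Nv // opprK mulrNN.
have /choice[S SP] fv := exP fv.1 fv.2.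
exists (fun f v => S (f, v)); split=> [v|f|f v a b g].
- by have [->] := SP (0, v).
- by have [_ ->] := SP (f, 0).
- by have [_ _ /(_ _ _ a b g)->] := SP (f *~ a, v *~ b).
Qed.

Section Bilinearity.
Variable S : dual_lattice n -> lattice n -> frakA n.
Hypotheses (S0v : forall v, S 0 v = 0) (Sf0 : forall f, S f 0 = 0).
Hypothesis SE : forall f v a b, is_generator f v ->
  S (f *~ a) (v *~ b) = symb_or0 f v *~ (a * b).

(** Writing [f] as a multiple of a primitive form, the relations of the first
    kind say that [S f] is additive on partial bases of the kernel, hence on the
    whole kernel by [partial_basis_additive]. *)
Lemma extended_symbol_addv f v1 v2 :
  f v1 = 0 -> f v2 = 0 -> S f (v1 + v2) = S f v1 + S f v2.
Proof.
have [f' [a [pf ->]]] := primitive_form_part f.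
have [->|a0] := eqVneq a 0; first by rewrite mulr0z !S0v addr0.
rewrite !mulz_lfunE => /eqP + /eqP; rewrite !mulf_eq0 (negPf a0) !orbF => fv1 fv2.
have [B hB] := ker_form_frame pf.
apply: (partial_basis_additive (ker_form_closed f') _ _ hB) => // [r s|x].
  move=> pb; have [h1 h2 h12] := ker_form_generators pf pb.
  rewrite -[r + s]mulr1z -[r in RHS]mulr1z -[s in RHS]mulr1z !SE //.
  by rewrite -mulrzDl (symb_or0_addv pf pb).
rewrite inE; have [x' [b [px ->]]] := primitive_vec_part x.
have [->|b0] := eqVneq b 0; first by move=> *; rewrite !mul0rz Sf0 mul0rz.
rewrite lfun_mulz mulf_eq0 (negPf b0) orbF => /eqP fx c.
by rewrite -mulrzA !SE // -mulrzA mulrA.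
Qed.

Lemma extended_symbol_addf f1 f2 v :
  f1 v = 0 -> f2 v = 0 -> S (f1 + f2) v = S f1 v + S f2 v.
Proof.
have [v' [a [pv ->]]] := primitive_vec_part v.
have [->|a0] := eqVneq a 0; first by rewrite mulr0z !Sf0 addr0.
rewrite !lfun_mulz => /eqP + /eqP; rewrite !mulf_eq0 (negPf a0) !orbF => fv1 fv2.
have [B hB] := ker_vec_frame pv.
apply: (partial_basis_additive (G := S^~ (v' *~ a)) (ker_vec_closed v') _ _ hB) => // [r s|x].
  move=> pb; have [h1 h2 h12] := ker_vec_generators pv pb.
  rewrite -[r + s]mulr1z -[r in RHS]mulr1z -[s in RHS]mulr1z !SE //.
  by rewrite -mulrzDl (symb_or0_addf pv pb).
rewrite inE; have [x' [b [px ->]]] := primitive_form_part x.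
have [->|b0] := eqVneq b 0; first by move=> *; rewrite !mul0rz S0v mul0rz.
rewrite mulz_lfunE mulf_eq0 (negPf b0) orbF => /eqP fx c.
by rewrite -mulrzA !SE // -mulrzA mulrAC.
Qed.

Lemma Phi_extended_symbol f v : f v = 0 ->
  val (Phi n (S f v)) = tens (form_incl f) (vec_incl v).
Proof.
have [f' [a [pf ->]]] := primitive_form_part f.
have [v' [b [pv ->]]] := primitive_vec_part v.
rewrite form_incl_mulz vec_incl_mulz tensZl tensZr => fv0.
have [->|a0] := eqVneq a 0; first by rewrite S0v !raddf0 scale0r.
have [->|b0] := eqVneq b 0; first by rewrite Sf0 !raddf0 scale0r scaler0.
have g : is_generator f' v'.
  split=> //; apply/eqP; move/eqP: fv0.
  by rewrite mulz_lfunE lfun_mulz !mulf_eq0 (negPf a0) (negPf b0) !orbF.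
by rewrite SE // symb_or0E !raddfMz /= Phi_symb -scaler_int intrM scalerA.
Qed.
End Bilinearity.
End ExtendedSymbol.

(** * Functions additive on a subgroup *)

Section AdditiveOn.
Variables (L M : zmodType) (K : zmodClosed L) (G : L -> M).
Hypothesis GD : {in K &, {morph G : x y / x + y}}.

Lemma additive_on0 : G 0 = 0.
Proof. by apply: (addrI (G 0)); rewrite -GD ?rpred0 // !addr0. Qed.

Lemma additive_onN : {in K, {morph G : x / - x}}.
Proof.
move=> x xK; apply: (addrI (G x)).
by rewrite -GD ?rpredN // !subrr additive_on0.
Qed.

Lemma additive_onMz a : {in K, {morph G : x / x *~ a}}.
Proof.
have nat k x : x \in K -> G (x *+ k) = G x *+ k.
  move=> xK; elim: k => [|k IH]; first by rewrite !mulr0n additive_on0.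
  by rewrite !mulrS GD ?rpredMn // IH.
move=> x xK; case: a => k; first exact: nat.
by rewrite NegzE !mulrNz additive_onN ?rpredMn // nat.
Qed.

Lemma additive_on_sum (I : Type) (r : seq I) (P : pred I) (F : I -> L) :
  (forall i, P i -> F i \in K) ->
  G (\sum_(i <- r | P i) F i) = \sum_(i <- r | P i) G (F i).
Proof.
move=> FK; pose Q x y := x \in K /\ G x = y.
suff [] : Q (\sum_(i <- r | P i) F i) (\sum_(i <- r | P i) G (F i)) by [].
apply: big_rec2; first by split; rewrite ?rpred0 ?additive_on0.
by move=> i y x /FK FiK [xK <-]; split; rewrite ?rpredD ?GD.
Qed.
End AdditiveOn.

(** * Rigidity of partially biadditive functions *)

(** The tensors of the pairs in [D_offdiag] and [D_diag] form a basis of the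
    traceless tensors, so their vanishing would suffice for a function induced by
    a linear map on tensors. Only partial biadditivity is available here: sums may
    be split in one variable as long as every term pairs to zero with the other. *)

Section Vanishing.
Variables (m : nat) (M : zmodType).
Local Notation n := m.+3.
Implicit Types (f g : dual_lattice n) (v w : lattice n) (i j k : 'I_n).
Hypothesis M_tf : forall (x : M) (a : int), a != 0 -> x *~ a = 0 -> x = 0.
Local Notation E i := (dcoord i : dual_lattice n).
Local Notation e j := (delta_mx j 0 : lattice n).

Variable D : dual_lattice n -> lattice n -> M.
Hypothesis D_addv : forall f v w,
  f v = 0 -> f w = 0 -> D f (v + w) = D f v + D f w.
Hypothesis D_addf : forall f g v,
  f v = 0 -> g v = 0 -> D (f + g) v = D f v + D g v.
Hypothesis D_offdiag : forall i j, i != j -> D (E i) (e j) = 0.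
Hypothesis D_diag : forall i, i != ord0 ->
  D (E i + E ord0) (e i - e ord0) = 0.

Let Kf f : zmodClosed (lattice n) :=
  HB.pack (ker_form f) (GRing.isZmodClosed.Build _ (ker_form f) (ker_form_closed f)).
Let Kv v : zmodClosed (dual_lattice n) :=
  HB.pack (ker_vec v) (GRing.isZmodClosed.Build _ (ker_vec v) (ker_vec_closed v)).

Let Kf_add f : {in Kf f &, {morph D f : x y / x + y}}.
Proof. by move=> x y /eqP fx /eqP fy; apply: D_addv. Qed.
Let Kv_add v : {in Kv v &, {morph D^~ v : x y / x + y}}.
Proof. by move=> x y /eqP fx /eqP fy; apply: D_addf. Qed.

Lemma D_oppv f v : f v = 0 -> D f (- v) = - D f v.
Proof. by move=> fv; rewrite (additive_onN (@Kf_add f)) //; apply/eqP. Qed.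
Lemma D_oppf f v : f v = 0 -> D (- f) v = - D f v.
Proof. by move=> fv; apply: (additive_onN (@Kv_add v)); apply/eqP. Qed.
Lemma D_mulzv f v a : f v = 0 -> D f (v *~ a) = D f v *~ a.
Proof. by move=> fv; rewrite (additive_onMz (@Kf_add f)) //; apply/eqP. Qed.
Lemma D_mulzf f v a : f v = 0 -> D (f *~ a) v = D f v *~ a.
Proof. by move=> fv; apply: (additive_onMz (@Kv_add v)); apply/eqP. Qed.

Lemma D_basis_vec f j : f (e j) = 0 -> D f (e j) = 0.
Proof.
move=> fj; have K0 k : f (e k) = 0 \/ dcoord k (e j) = 0.
  by rewrite dcoord_delta; case: eqVneq => [->|_]; [left | right].
rewrite {1}(form_coord f) (additive_on_sum (@Kv_add (e j))) => [|k _].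
  rewrite big1 // => k _; have [fk0|kj0] := K0 k.
    by rewrite fk0 mulr0z (additive_on0 (@Kv_add (e j))).
  rewrite D_mulzf // D_offdiag ?mul0rz //.
  by apply: contra_eq_neq kj0 => ->; rewrite dcoord_delta eqxx.
by apply/eqP; rewrite mulz_lfunE; case: (K0 k) => ->; rewrite ?mulr0 ?mul0r.
Qed.

Lemma D_basis_form i v : v i 0 = 0 -> D (E i) v = 0.
Proof.
move=> vi; have K0 k : v k 0 = 0 \/ dcoord i (e k) = 0.
  by rewrite dcoord_delta; case: eqVneq => [<-|_]; [left | right].
rewrite {1}(vec_coord v) (additive_on_sum (@Kf_add (E i))) => [|k _].
  rewrite big1 // => k _; have [vk0|ik0] := K0 k.
    by rewrite vk0 mulr0z (additive_on0 (@Kf_add (E i))).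
  rewrite D_mulzv // D_offdiag ?mul0rz //.
  by apply: contra_eq_neq ik0 => ->; rewrite dcoord_delta eqxx.
by apply/eqP; rewrite lfun_mulz; case: (K0 k) => ->; rewrite ?mulr0 ?mul0r.
Qed.

(** Up to scaling, the pair [(a E_i + b E_j, b e_i - a e_j)] is the general pair
    supported on two coordinates with nonzero entries. Since [ker f] is spanned,
    up to a nonzero multiple, by the vectors [f_j e_i - f_i e_j], the values
    [plane i j a b] determine [D]. *)
Definition plane i j a b := D (E i *~ a + E j *~ b) (e i *~ b - e j *~ a).

Lemma coef2_l i j a b : i != j -> (E i *~ a + E j *~ b) (e i) = a.
Proof.
by move=> ij; rewrite add_lfunE !mulz_lfunE !dcoord_delta eqxx eq_sym (negPf ij) mul1r mul0r addr0.
Qed.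

Lemma coef2_r i j a b : i != j -> (E i *~ a + E j *~ b) (e j) = b.
Proof. by move=> ij; rewrite addrC coef2_l // eq_sym. Qed.

Lemma entry_mulz v a i : (v *~ a) i 0 = v i 0 * a.
Proof. by rewrite -!dcoordE lfun_mulz. Qed.

Lemma lfun2 f i j a b : f (e i *~ b - e j *~ a) = f (e i) * b - f (e j) * a.
Proof. by rewrite linearB /= !lfun_mulz. Qed.

(** The coordinates of [f] away from [i] and [j] do not matter, since the
    corresponding [E_k] contribute only off-diagonal values. *)
Lemma D_plane_vec f i j a b : i != j -> f (e i) = a -> f (e j) = b ->
  D f (e i *~ b - e j *~ a) = plane i j a b.
Proof.
move=> ij fi fj; rewrite /plane.
set f0 := E i *~ a + E j *~ b; set w := _ - _.
have f0w : f0 w = 0 by rewrite lfun2 coef2_l // coef2_r // mulrC subrr.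
pose g := f - f0.
have gi : g (e i) = 0 by rewrite add_lfunE opp_lfunE coef2_l // fi subrr.
have gj : g (e j) = 0 by rewrite add_lfunE opp_lfunE coef2_r // fj subrr.
have -> : f = f0 + g by rewrite addrC subrK.
rewrite D_addf //; last by rewrite lfun2 gi gj !mul0r subrr.
suff -> : D g w = 0 by rewrite addr0.
rewrite D_addv ?D_oppv ?D_mulzv ?lfun_mulz ?gi ?gj ?mul0r //; last first.
  by rewrite linearN /= lfun_mulz gj mul0r oppr0.
by rewrite !D_basis_vec // !mul0rz subrr.
Qed.

(** Dual to [D_plane_vec]. *)
Lemma D_plane_form v i j a b : i != j -> v i 0 = b -> v j 0 = - a ->
  D (E i *~ a + E j *~ b) v = plane i j a b.
Proof.
move=> ij vi vj; rewrite /plane.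
set f0 := E i *~ a + E j *~ b; set w := _ - _.
have f0w : f0 w = 0 by rewrite lfun2 coef2_l // coef2_r // mulrC subrr.
pose u := v - w.
have ui : E i u = 0.
  by rewrite linearB /= lfun2 !dcoord_delta dcoordE vi eqxx (negPf ij) mul1r mul0r subr0 subrr.
have uj : E j u = 0.
  by rewrite linearB /= lfun2 !dcoord_delta dcoordE vj eqxx eq_sym (negPf ij) mul1r mul0r sub0r subrr.
have -> : v = w + u by rewrite addrC subrK.
rewrite D_addv //; last by rewrite add_lfunE !mulz_lfunE ui uj !mul0r addr0.
suff -> : D f0 u = 0 by rewrite addr0.
rewrite D_addf ?D_mulzf ?mulz_lfunE ?ui ?uj ?mul0r //.
by rewrite !D_basis_form -?dcoordE // !mul0rz addr0.
Qed.

Lemma plane_antisym i j a b : i != j -> plane i j a b = - plane j i b a.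
Proof.
move=> ij; rewrite /plane -D_oppv; first by rewrite opprB (addrC (E j *~ b)).
by rewrite lfun2 coef2_l ?coef2_r 1?eq_sym // mulrC subrr.
Qed.

Lemma planeNN i j a b : i != j -> plane i j (- a) (- b) = plane i j a b.
Proof.
move=> ij; rewrite /plane !mulrNz -opprD -opprD.
have fv : (E i *~ a + E j *~ b) (e i *~ b - e j *~ a) = 0.
  by rewrite lfun2 coef2_l ?coef2_r // mulrC subrr.
by rewrite D_oppf ?D_oppv ?opprK // linearN /= fv oppr0.
Qed.

(** For [f = a E_i + b E_j + c E_k], apply [D f] to the identity
    [c (b e_i - a e_j) + a (c e_j - b e_k) = b (c e_i - a e_k)] in [ker f]. *)
Lemma plane_cocycle i j k a b c : i != j -> j != k -> i != k ->
  plane i j a b *~ c + plane j k b c *~ a = plane i k a c *~ b.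
Proof.
move=> ij jk ik; pose f := E i *~ a + E j *~ b + E k *~ c.
have fi : f (e i) = a.
  by rewrite add_lfunE coef2_l // mulz_lfunE dcoord_delta eq_sym (negPf ik) mul0r addr0.
have fj : f (e j) = b.
  by rewrite add_lfunE coef2_r // mulz_lfunE dcoord_delta eq_sym (negPf jk) mul0r addr0.
have fk : f (e k) = c.
  by rewrite add_lfunE add_lfunE !mulz_lfunE !dcoord_delta (negPf ik) (negPf jk) eqxx mul1r !mul0r !add0r.
have ker p q : f (e p *~ f (e q) - e q *~ f (e p)) = 0.
  by rewrite lfun2 mulrC subrr.
have kij := ker i j; have kjk := ker j k; have kik := ker i k.
rewrite fi fj fk in kij kjk kik.
rewrite -(D_plane_vec ij fi fj) -(D_plane_vec jk fj fk) -(D_plane_vec ik fi fk) -!D_mulzv // -D_addv.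
- congr (D _ _); rewrite !mulrzBl -!mulrzA addrA.
  rewrite [a * c]mulrC subrK.
  by rewrite (mulrC b c) (mulrC a b).
- by rewrite lfun_mulz kij mul0r.
- by rewrite lfun_mulz kjk mul0r.
Qed.

Lemma plane11 i j : i != j -> plane i j 1 1 = 0.
Proof.
have q0 k : k != ord0 -> plane k ord0 1 1 = 0.
  by move=> k0; rewrite /plane !mulr1z D_diag.
have q0' k : k != ord0 -> plane ord0 k 1 1 = 0.
  by move=> k0; rewrite plane_antisym 1?eq_sym // q0 ?oppr0.
move=> ij; have [i0|i0] := eqVneq i ord0; first by rewrite i0 q0' // -i0 eq_sym.
have [->|j0] := eqVneq j ord0; first exact: q0.
have := plane_cocycle 1 1 1 i0 _ ij; rewrite eq_sym => /(_ j0).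
by rewrite !mulr1z q0 // q0' // addr0.
Qed.

Lemma third_index i j : exists k, (i != k) && (j != k).
Proof.
have : (0 < #|~: [set i; j]|)%N.
  rewrite cardsCs setCK card_ord cards2 subn_gt0.
  by case: (_ != _).
by case/card_gt0P => k; rewrite !inE negb_or !(eq_sym k); exists k.
Qed.

(** The cocycle identity at [(1, b, 1)]. *)
Lemma plane1_indep i j k b : i != j -> k != j -> plane i j 1 b = plane k j 1 b.
Proof.
move=> ij kj; have [->//|ik] := eqVneq i k.
have := @plane_cocycle i j k 1 b 1 ij _ ik; rewrite eq_sym => /(_ kj).
rewrite !mulr1z plane11 // mul0rz (@plane_antisym j) 1?eq_sym // => /eqP.
by rewrite subr_eq0 => /eqP.
Qed.

(** Permuting the three indices by [plane1_indep] and by antisymmetry brings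
    [plane i j 1 (- 1)] back to its opposite. *)
Lemma plane1N1 i j : i != j -> plane i j 1 (- 1) = 0.
Proof.
have anti p q : p != q -> plane p q 1 (-1) = - plane q p 1 (-1).
  by move=> pq; rewrite plane_antisym // -(@planeNN q p) 1?eq_sym // opprK.
move=> ij; have [k /andP[ik jk]] := third_index i j.
have ji : j != i by rewrite eq_sym.
have ki : k != i by rewrite eq_sym.
have kj : k != j by rewrite eq_sym.
have E2 : plane i j 1 (-1) = - plane i j 1 (-1).
  by rewrite {1}(plane1_indep _ ij kj) anti // (plane1_indep _ jk ik) (anti i) // opprK
    (plane1_indep _ ki ji) anti.
apply: (@M_tf _ 2) => //; rewrite -[2]/(1 + 1) mulrzDr mulr1z {1}E2.
by rewrite addNr.
Qed.

(** The cocycle identity at [(1, - 1, c)]. *)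
Lemma plane1N i j c : i != j -> plane i j 1 (- c) = - plane i j 1 c.
Proof.
move=> ij; have [k /andP[ik jk]] := third_index i j.
have kj : k != j by rewrite eq_sym.
have := @plane_cocycle i k j 1 (- 1) c ik kj ij.
rewrite plane1N1 // mul0rz add0r mulr1z mulrNz mulr1z.
by rewrite -planeNN // opprK (plane1_indep _ kj ij).
Qed.

(** All the relations used so far are compatible with [plane i j 1 p] being a
    derivation evaluated at [p]. What kills it is that derivations vanish on
    integers: splitting [E_i + E_j + E_k] in [ker v], for the vector [v] with
    coordinates [p], [- 1] and [1 - p] at [i], [j] and [k], shows that
    [plane i j 1 p] does not change when [p] is decreased by [1]. *)
Lemma plane1 i j b : i != j -> plane i j 1 b = 0.
Proof.
move=> ij; have [k /andP[ik jk]] := third_index i j.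
have kj : k != j by rewrite eq_sym.
have step p : plane i j 1 p = plane i j 1 (p - 1).
  pose v := (e i - e j) *~ p + (e k - e j) *~ (1 - p).
  have vE q : v q 0 = ((q == i)%:R - (q == j)%:R) * p
                    + ((q == k)%:R - (q == j)%:R) * (1 - p).
    by rewrite mxE !entry_mulz !mxE !eqxx !andbT.
  have vi : v i 0 = p.
    by rewrite vE eqxx (negPf ij) (negPf ik) subrr mul0r addr0 subr0 mul1r.
  have vk : v k 0 = 1 - p.
    by rewrite vE eqxx (negPf kj) [k == i]eq_sym (negPf ik) subrr mul0r add0r subr0 mul1r.
  have vj : v j 0 = - 1.
    rewrite vE eqxx [j == i]eq_sym (negPf ij) [j == k]eq_sym (negPf kj).
    by rewrite sub0r !mulN1r -opprD addrC subrK.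
  (* the two summands of f are the forms of plane i j 1 p and
     plane k j 1 (1 - p), and each of them kills v *)
  have H1 := D_plane_form ij vi vj.
  have H2 := D_plane_form kj vk vj.
  pose f := E i *~ 1 + E j *~ p + (E k *~ 1 + E j *~ (1 - p)).
  have fE : f = E i + E j + E k.
    rewrite /f !mulr1z addrACA -mulrzDr [p + _]addrC subrK mulr1z.
    by rewrite addrAC.
  have fi : f (e i) = 1.
    by rewrite fE !add_lfunE !dcoord_delta eqxx ![_ == i]eq_sym (negPf ij) (negPf ik) !addr0.
  have fj : f (e j) = 1.
    by rewrite fE !add_lfunE !dcoord_delta eqxx (negPf ij) (negPf kj) addr0 add0r.
  have fk : f (e k) = 1.
    by rewrite fE !add_lfunE !dcoord_delta eqxx (negPf ik) (negPf jk) !add0r.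
  have Dij := D_plane_vec ij fi fj; have Dkj := D_plane_vec kj fk fj.
  rewrite !mulr1z !plane11 // in Dij Dkj.
  have fij : f (e i - e j) = 0 by rewrite linearB /= fi fj subrr.
  have fkj : f (e k - e j) = 0 by rewrite linearB /= fk fj subrr.
  have : D f v = 0.
    by rewrite /v D_addv ?D_mulzv ?lfun_mulz ?fij ?fkj ?mul0r // Dij Dkj !mul0rz addr0.
  have kf (q : 'I_n) c : v q 0 = c -> (E q *~ 1 + E j *~ c) v = 0.
    move=> vq; rewrite add_lfunE !mulz_lfunE !dcoordE vq vj mulr1 mulN1r subrr //.
  rewrite D_addf ?kf // H1 H2 (plane1_indep _ kj ij) -[1 - p]opprB plane1N // => /eqP.
  by rewrite subr_eq0 => /eqP.
have q0 : plane i j 1 0 = 0.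
  by rewrite /plane mulr0z addr0 mulr0z sub0r !mulr1z D_basis_form // mxE !mxE (negPf ij) oppr0.
elim/int_ind: b => [//|q IH|q IH]; first by rewrite step -addn1 PoszD addrK.
by rewrite -addn1 PoszD opprD -step.
Qed.

(** The cocycle identity at [(1, a, b)]. *)
Lemma plane_eq0 i j a b : i != j -> plane i j a b = 0.
Proof.
move=> ij; have [k /andP[ik jk]] := third_index i j.
have ki : k != i by rewrite eq_sym.
have kj : k != j by rewrite eq_sym.
have := @plane_cocycle k i j 1 a b ki ij kj.
by rewrite !plane1 // !mul0rz add0r mulr1z.
Qed.

(** If [f_i] is nonzero, then [f_i v] is the sum over [j] of
    [v_j (f_i e_j - f_j e_i)], all in [ker f]; torsion-freeness then allows
    dividing by [f_i]. *)
Lemma partially_biadditive_eq0 f v : f v = 0 -> D f v = 0.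
Proof.
move=> fv; case: (pselect (exists i, f (e i) != 0)) => [[i fi]|no]; last first.
  have -> : f = 0.
    rewrite (form_coord f) big1 // => j _; case: (eqVneq (f (e j)) 0) => [->//|fj].
    by case: no; exists j.
  exact: (additive_on0 (@Kv_add v)).
pose w j := e j *~ f (e i) - e i *~ f (e j).
have fw j : f (w j) = 0 by rewrite lfun2 mulrC subrr.
have vE : v *~ f (e i) = \sum_j w j *~ v j 0.
  rewrite (eq_bigr (fun j => e j *~ v j 0 *~ f (e i) - e i *~ (f (e j) * v j 0))); last first.
    by move=> j _; rewrite mulrzBl -!mulrzA [f (e i) * _]mulrC.
  rewrite sumrB -mulrz_suml -vec_coord -mulrz_sumr.
  suff -> : \sum_j f (e j) * v j 0 = f v by rewrite fv mulr0z subr0.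
  rewrite {2}(vec_coord v) linear_sum; apply: eq_bigr => j _.
  by rewrite /= lfun_mulz.
apply: (M_tf fi); rewrite -D_mulzv // vE (additive_on_sum (@Kf_add f)) => [|j _].
  rewrite big1 // => j _; rewrite D_mulzv //.
  have [->|ji] := eqVneq j i.
    by rewrite /w subrr (additive_on0 (@Kf_add f)) mul0rz.
  by rewrite (D_plane_vec ji erefl erefl) plane_eq0 // mul0rz.
by apply/eqP; rewrite lfun_mulz fw mul0r.
Qed.
End Vanishing.

(** * The inverse of the linearization map *)

Lemma presented_ind (F : fieldType) (G : choiceType)
    (rel : {freeg G / F} -> Prop) (P : presented rel -> Prop) :
  P 0 -> (forall a x y, P x -> P y -> P (a *: x + y)) ->
  (forall g, P (pres_gen rel g)) -> forall x, P x.
Proof.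
move=> P0 Plin Pgen x; rewrite -[x]pres_piK -[repr x]freeg_sumE.
elim/big_ind: _ => [|y z Py Pz|g _].
- suff -> : pres_pi rel 0 = 0 by [].
  by apply: (addrI (pres_pi rel 0)); rewrite -pres_piD !addr0.
- by rewrite pres_piD -[pres_pi rel y]scale1r; apply: Plin.
have -> : << coeff g (repr x) *g g >> = coeff g (repr x) *: << g >> :> {freeg G / F}.
  by apply/eqP/freeg_eqP => t; rewrite coeffZ !coeffU mul1r.
rewrite -pres_pi_scale -[pres_scale _ _]addr0.
exact: (Plin _ (pres_gen rel g) 0 (Pgen g) P0).
Qed.

Lemma tensor_lift (F : fieldType) (U V W : lmodType F) (h : U -> V -> W) :
  (forall v, linear (h^~ v)) -> (forall u, linear (h u)) ->
  exists H : {linear tensor U V -> W}, forall u v, H (tens u v) = h u v.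
Proof.
move=> hl hr; pose h2 (p : U * V) := h p.1 p.2.
have hDl u1 u2 v : h (u1 + u2) v = h u1 v + h u2 v.
  by have := hl v 1 u1 u2; rewrite !scale1r.
have hDr u v1 v2 : h u (v1 + v2) = h u v1 + h u v2.
  by have := hr u 1 v1 v2; rewrite !scale1r.
have h0v v : h 0 v = 0 by apply: (addrI (h 0 v)); rewrite -hDl !addr0.
have hu0 u : h u 0 = 0 by apply: (addrI (h u 0)); rewrite -hDr !addr0.
have hZl a u v : h (a *: u) v = a *: h u v.
  by have := hl v a u 0; rewrite h0v !addr0.
have hZr a u v : h u (a *: v) = a *: h u v.
  by have := hr u a v 0; rewrite hu0 !addr0.
have hrel r : tensor_rel r -> fglift h2 r = 0.
  have lin := fglift_linear h2.
  pose H : {linear {freeg (U * V)%type / F} -> W} :=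
    HB.pack (fglift h2) (GRing.isLinear.Build _ _ _ _ _ lin).
  have HU p : H << p >> = h2 p by rewrite /= liftU scale1r.
  rewrite -[fglift h2]/(H : _ -> _).
  case=> [u1 u2 v|u v1 v2|a u v|a u v]; rewrite !linearB ?linearZ !HU /h2 /=.
  - by rewrite hDl addrAC addrK subrr.
  - by rewrite hDr addrAC addrK subrr.
  - by rewrite hZl -scalerDr subrr scaler0.
  - by rewrite hZr -scalerDr subrr scaler0.
exists (pres_lift hrel) => u v; exact: pres_lift_gen.
Qed.

Section Inverse.
Variable m : nat.
Local Notation n := m.+3.
Local Notation E i := (dcoord i : dual_lattice n).
Local Notation e j := (delta_mx j 0 : lattice n).
Local Notation eQ i := (delta_mx i 0 : vecQ n).

Lemma vec_incl_delta j : vec_incl (e j) = eQ j.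
Proof. by apply/matrixP => i k; rewrite !mxE; case: (_ && _). Qed.

Lemma form_incl_coord i (x : vecQ n) : form_incl (E i) x = x i 0.
Proof.
rewrite lfunE /= (bigD1 i) //= dcoord_delta eqxx mulr1 big1 ?addr0 // => j ji.
by rewrite dcoord_delta eq_sym (negPf ji) mulr0.
Qed.

Lemma vecQ_coord (x : vecQ n) : x = \sum_j x j 0 *: vec_incl (e j).
Proof.
rewrite {1}[x]matrix_sum_delta; apply: eq_bigr => j _.
by rewrite big_ord1 vec_incl_delta.
Qed.

Lemma dualQ_coord (p : dualQ n) : p = \sum_i p (eQ i) *: form_incl (E i).
Proof.
apply/lfunP => x; rewrite sum_lfunE [in LHS](vecQ_coord x) linear_sum.
apply: eq_bigr => j _; rewrite linearZ scale_lfunE form_incl_coord vec_incl_delta.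
exact: mulrC.
Qed.

Lemma tensor_basis_ind (P : tensor (dualQ n) (vecQ n) -> Prop) :
  P 0 -> (forall a x y, P x -> P y -> P (a *: x + y)) ->
  (forall i j, P (tens (form_incl (E i)) (vec_incl (e j)))) -> forall t, P t.
Proof.
move=> P0 Plin Pb; apply: presented_ind => // -[p x].
have PD y z : P y -> P z -> P (y + z) by move=> Py; rewrite -[y]scale1r; apply: Plin.
have PZ a y : P y -> P (a *: y) by move=> Py; rewrite -[_ *: _]addr0; apply: Plin.
have tens0l x' : tens (0 : dualQ n) x' = 0 by rewrite -(scale0r 0) tensZl scale0r.
have tens0r p' : tens p' (0 : vecQ n) = 0 by rewrite -(scale0r 0) tensZr scale0r.
rewrite -/(tens p x) (dualQ_coord p).
elim/big_ind: _ => [|y z|i _]; rewrite ?tens0l ?tensDl ?tensZl //; first exact: PD.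
apply: (PZ _ _); rewrite (vecQ_coord x).
elim/big_ind: _ => [|y z|j _]; rewrite ?tens0r ?tensDr ?tensZr //; first exact: PD.
exact: PZ.
Qed.

Lemma tens_sum_diff (f g : dual_lattice n) (v w : lattice n) :
  tens (form_incl (f + g)) (vec_incl (v - w)) =
    tens (form_incl f) (vec_incl v) - tens (form_incl f) (vec_incl w)
    + (tens (form_incl g) (vec_incl v) - tens (form_incl g) (vec_incl w)).
Proof.
by rewrite -[- w]/(w *~ -1) form_inclD vec_inclD vec_incl_mulz tensDl !tensDr !tensZr !scaleN1r.
Qed.

Lemma addr_telescope4 (V : zmodType) (a b c d : V) :
  a - b + (c - d) + b - c = a - d.
Proof. by rewrite (addrAC (a - b)) subrK addrA (addrAC (a + c)) addrK. Qed.

(** [Psi] sends the basis tensors [E_i (x) e_j] off the diagonal to symbols, and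
    [E_i (x) e_i] to the combination of symbols whose image under [Phi] is
    [E_i (x) e_i - E_0 (x) e_0]. Being defined on all tensors, it inverts [Phi]
    only on the kernel of the trace, whence the correction term. It is a left
    inverse because the difference [D] between a symbol and its image under
    [Psi] after tensoring falls under [partially_biadditive_eq0]. *)
Lemma Phi_partial_inverse : exists Psi : {linear tensor (dualQ n) (vecQ n) -> frakA n},
  (forall t, val (Phi n (Psi t)) =
     t - trace_map n t *: tens (form_incl (E 0)) (vec_incl (e 0))) /\
  cancel (Phi n) (fun s => Psi (val s)).
Proof.
have [S [S0v Sf0 SE]] := extended_symbol m.
have SDv := extended_symbol_addv S0v Sf0 SE.
have SDf := extended_symbol_addf S0v Sf0 SE.
have PhiS := Phi_extended_symbol S0v Sf0 SE.
(* E_i (x) e_i - E_0 (x) e_0 =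
   (E_i + E_0) (x) (e_i - e_0) + E_i (x) e_0 - E_0 (x) e_i *)
pose h (i : 'I_n) := if i == 0 then 0 else
  S (E i + E 0) (e i - e 0) + S (E i) (e 0) - S (E 0) (e i).
pose c (i j : 'I_n) := if i == j then h i else S (E i) (e j).
pose T (p : dualQ n) (x : vecQ n) : frakA n :=
  \sum_i \sum_j (p (eQ i) * x j 0) *: c i j.
have [x a p q|p a x y|Psi PsiE] := tensor_lift (h := T).
- rewrite scaler_sumr -big_split; apply: eq_bigr => i _ /=.
  rewrite scaler_sumr -big_split; apply: eq_bigr => j _ /=.
  by rewrite add_lfunE scale_lfunE scalerA -scalerDl mulrDl -mulrA.
- rewrite scaler_sumr -big_split; apply: eq_bigr => i _ /=.
  rewrite scaler_sumr -big_split; apply: eq_bigr => j _ /=.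
  by rewrite !mxE scalerA -scalerDl mulrDr mulrCA.
have PsiEe i j : Psi (tens (form_incl (E i)) (vec_incl (e j))) = c i j.
  rewrite PsiE /T (bigD1 i) //= (bigD1 j) //= !big1 ?addr0.
  - by rewrite form_incl_coord vec_incl_delta !mxE !eqxx mulr1 scale1r.
  - move=> k ki; rewrite big1 // => l _.
    by rewrite form_incl_coord !mxE eq_sym (negPf ki) mul0r scale0r.
  - by move=> k kj; rewrite vec_incl_delta !mxE (negPf kj) mulr0 scale0r.
exists Psi; split.
  apply: tensor_basis_ind => [|a x y IHx IHy|i j].
  - by rewrite !raddf0 scale0r subr0.
  - rewrite !linearP /= IHx IHy scalerBr scalerDl opprD.
    by rewrite -scalerA addrACA.
  rewrite PsiEe trace_map_tens form_inclE dcoord_delta /c.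
  have [ij|ij] := eqVneq i j; last first.
    by rewrite scale0r subr0 PhiS // dcoord_delta (negPf ij).
  rewrite -{j}ij scale1r /h; have [->|i0] := eqVneq i 0.
    by rewrite raddf0 subrr.
  have Ei0 : E i (e 0) = 0 by rewrite dcoord_delta (negPf i0).
  have E0i : E 0 (e i) = 0 by rewrite dcoord_delta eq_sym (negPf i0).
  have Esum : (E i + E 0) (e i - e 0) = 0.
    by rewrite linearB /= !add_lfunE Ei0 E0i !dcoord_delta !eqxx addr0 add0r subrr.
  by rewrite !raddfB !raddfD /= !PhiS // tens_sum_diff addr_telescope4.
pose D f v := S f v - Psi (tens (form_incl f) (vec_incl v)).
have D0 (f : dual_lattice n) v : f v = 0 -> D f v = 0.
  apply: partially_biadditive_eq0 => [x a a0||||].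
  - rewrite -scaler_int => /eqP; rewrite scaler_eq0 intr_eq0 (negPf a0) => /eqP //.
  - move=> f' v1 v2 fv1 fv2.
    by rewrite /D SDv // vec_inclD tensDr raddfD /= opprD addrACA.
  - move=> f1 f2 v' fv1 fv2.
    by rewrite /D SDf // form_inclD tensDl raddfD /= opprD addrACA.
  - by move=> i j ij; rewrite /D PsiEe /c (negPf ij) subrr.
  - move=> i i0; rewrite /D tens_sum_diff raddfD !raddfB /= !PsiEe /c eqxx (negPf i0).
    rewrite eq_sym (negPf i0) eqxx /h eqxx (negPf i0) subr0.
    by rewrite -addrA [- _ + _]addrC addrA subrK addrK subrr.
apply: presented_ind => [|a x y IHx IHy|[[f v] g]].
- by rewrite !raddf0.
- by rewrite !linearP /= IHx IHy.
have gen : is_generator f v by apply/asboolP.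
have -> : pres_gen (@frakA_rel n) (exist _ (f, v) g) = symb gen.
  by congr (pres_gen _ _); apply: val_inj.
rewrite Phi_symb; have [pf pv fv] := gen.
have /eqP := D0 _ _ fv; rewrite subr_eq0 => /eqP <-.
by have := SE _ _ 1 1 gen; rewrite mulr1 !mulr1z (symb_or0E gen).
Qed.
End Inverse.

Theorem theorem2 (n : nat) (hn : (3 <= n)%N) :
  bijective (Phi n : {linear frakA n -> sl n}).
Proof.
case: n hn => [|[|[|m]]] // _.
have [Psi [PhiK PsiK]] := Phi_partial_inverse m.
exists (fun s => Psi (val s)) => // s; apply: val_inj; rewrite PhiK.
by have /eqP -> := valP s; rewrite scale0r subr0.
Qed.
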